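(* Fix $0<a<1$ and let $L=L_N=N^a$ (see the convention on $L$ in the context). Let $0<p\le 1/2$, $\epsilon>0$ and $0<\nu\le \frac{0.15}{1+3p}$. Run the efficient discrete-time rewire-to-random evolving voter model with parameter $\nu$, started from a random $L$-regular graph on $N$ vertices whose vertices are independently assigned state $1$ with probability $p$ and state $0$ with probability $1-p$. Let $\tau$ be the first time (number of updates) at which there are no discordant edges. Then, with probability tending to $1$ as $N\to\infty$, $\tau<3pNL$ and the fraction of vertices in state $1$ at time $\tau$ is between $p-\epsilon$ and $p+\epsilon$.
   Context: Convention on $L$: $L=L_N$ are positive integers with $NL$ even and $L_N/N^a\to 1$ as $N\to\infty$, where $0<a<1$ is fixed. Efficient discrete-time rewire-to-random evolving voter model with parameter $\nu>0$: the state of the process is a simple graph on the vertex set $V=\{1,\dots,N\}$ together with an opinion (state) in $\{0,1\}$ at each vertex. An edge is discordant if its two endpoints have different states. At each step (update), as long as there is a discordant edge, a discordant edge is picked uniformly at random and given one of its two orientations $(v,u)$, each with probability $1/2$ ($v$ is the root of the update). Then, independently, with probability $\nu/L$ a voting (relabeling) event occurs: $v$ adopts the state of $u$. Otherwise, with probability $1-\nu/L$, a rewiring event occurs: the edge between $v$ and $u$ is deleted and replaced by an edge from $v$ to a vertex $z$ chosen uniformly at random from all vertices that are different from $v$ and were not neighbors of $v$ (if there is no such vertex, the graph is left unchanged). Once there are no discordant edges the process stays constant. Initial graph: uniformly distributed over simple $L$-regular graphs on $V$, independent of the initial opinions. *)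

(* Defs.v *)
(* MathComp / MathComp-Analysis. *)
From HB Require Import structures.
From mathcomp Require Import all_boot all_order all_algebra.
From mathcomp Require Import all_classical all_reals all_analysis.

Set Implicit Arguments.
Unset Strict Implicit.
Unset Printing Implicit Defensive.

Import Order.TTheory GRing.Theory Num.Theory.
Import numFieldNormedType.Exports.

Local Open Scope ring_scope.

(* A simple graph on 'I_N is its set of edges, each a 2-element vertex set. *)
Definition sgraph (N : nat) :=
  {E : {set {set 'I_N}} | [forall e in E, #|e| == 2%N]}.

Definition neighbors N (g : sgraph N) (v : 'I_N) : {set 'I_N} :=
  [set u | [set v; u]%SET \in val g].

Definition regular N (k : nat) (g : sgraph N) : bool :=
  [forall v, #|neighbors g v| == k].

(* A graph together with an opinion at each vertex (true is 1, false is 0). *)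
Definition state (N : nat) := (sgraph N * {ffun 'I_N -> bool})%type.

Definition discordant N (s : state N) : {set {set 'I_N}} :=
  [set e in val s.1 | [exists x in e, exists y in e, s.2 x != s.2 y]].

Definition vote N (s : state N) (v u : 'I_N) : state N :=
  (s.1, [ffun w => if w == v then s.2 u else s.2 w]).

(* u is still a neighbor of v here, so it is never a rewiring target. *)
Definition rewire_targets N (s : state N) (v : 'I_N) : {set 'I_N} :=
  [set z | (z != v) && (z \notin neighbors s.1 v)].

Definition rewire_edges N (s : state N) (v u z : 'I_N) : {set {set 'I_N}} :=
  [set v; z]%SET |: (val s.1 :\ [set v; u]%SET).

Definition rewire_prob (R : realType) N (s : state N) (v u : 'I_N)
    (s' : state N) : R :=
  if rewire_targets s v == finset.set0 then (s' == s)%:R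
  else \sum_(z in rewire_targets s v) #|rewire_targets s v|%:R^-1 *
         ((val s'.1 == rewire_edges s v u z) && (s'.2 == s.2))%:R.

(* Each discordant edge {v, u} occurs in the double sum exactly twice, once per
   orientation (v, u) with root v; each orientation gets half its weight. *)
Definition evoter_trans (R : realType) (nu : R) (L N : nat)
    (s s' : state N) : R :=
  if discordant s == finset.set0 then (s' == s)%:R
  else \sum_(v : 'I_N) \sum_(u : 'I_N | [set v; u]%SET \in discordant s)
         (#|discordant s|%:R^-1 * 2^-1) *
         (nu / L%:R * (s' == vote s v u)%:R +
          (1 - nu / L%:R) * rewire_prob R s v u s').

Definition evoter_init (R : realType) (p : R) (L N : nat) (s : state N) : R :=
  ((regular L s.1)%:R / #|[set g : sgraph N | regular L g]%SET|%:R) *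
  \prod_(v : 'I_N) (if s.2 v then p else 1 - p).

Local Open Scope classical_set_scope.

(* The conditional law of the next state given the whole history is written in
   product form, so that histories of probability 0 impose no condition. *)
Definition markov_chain (R : realType) (d : measure_display)
    (T : measurableType d) (P : probability T R) (S : finType)
    (init : S -> R) (K : S -> S -> R) (X : nat -> T -> S) : Prop :=
  [/\ forall t s, measurable [set w | X t w = s],
      forall s, P [set w | X 0%N w = s] = (init s)%:E &
      forall (n : nat) (x : nat -> S),
        P [set w | forall i, (i <= n.+1)%N -> X i w = x i] =
        (P [set w | forall i, (i <= n)%N -> X i w = x i] *
         (K (x n) (x n.+1))%:E)%E].

Definition evoter_process (R : realType) (p nu : R) (L N : nat)
    (d : measure_display) (T : measurableType d) (P : probability T R)
    (X : nat -> T -> state N) : Prop :=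
  markov_chain P (@evoter_init R p L N) (@evoter_trans R nu L N) X.

(* t is the consensus time along the trajectory x; no t qualifies when the
   trajectory always has a discordant edge (infinite consensus time). *)
Definition is_tau N (x : nat -> state N) (t : nat) : Prop :=
  discordant (x t) = finset.set0 /\
  forall i, (i < t)%N -> discordant (x i) <> finset.set0.

Definition frac1 (R : realType) N (s : state N) : R :=
  #|[set v | s.2 v]%SET|%:R / N%:R.

(* Main.v *)
(**
While some edge is discordant, a rewiring removes one discordant edge and
creates a new one with probability close to 1/2, because the two orientations
of the chosen edge are equally likely and their roots have opposite opinions. A
vote at [v] creates at most [deg v] discordant edges and has probability
[nu / L]. Hence, as long as all degrees stay below about [(1 + 3p) L], the
number of discordant edges, initially about [p (1 - p) N L], drifts downwards at
speed at least [1/2 - nu (1 + 3p) >= 0.35 > 1/3] and must vanish before time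
[3 p N L]. In that time a vertex is chosen as a rewiring target at most about
[3 p L] times, so the degree bound does hold, by an exponential moment estimate;
and the number of ones is a martingale with at most about [3 p nu N] unit jumps,
so it moves by [O(sqrt N)] only. The three estimates are three nonnegative
potentials, added up into one supermartingale for the process stopped when it
leaves the states having a discordant edge and bounded degrees.
*)
Require Import Defs.
From HB Require Import structures.
From mathcomp Require Import all_boot all_order all_algebra.
From mathcomp Require Import all_classical all_reals all_analysis.
From mathcomp Require Import zify ring lra.

Set Implicit Arguments.
Unset Strict Implicit.
Unset Printing Implicit Defensive.

Import Order.TTheory GRing.Theory Num.Theory.
Import numFieldNormedType.Exports.

Local Open Scope classical_set_scope.
Local Open Scope ring_scope.

(** * Exit bound for a Markov chain on a finite type *)

Section finite_state_chain.
Context (R : realType) (d : measure_display) (T : measurableType d)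
  (P : probability T R).

Let pr (A : set T) : R := fine (P A).

Let prE (A : set T) : measurable A -> P A = (pr A)%:E.
Proof. by move=> mA; rewrite fineK // fin_num_measure. Qed.

Lemma fin_fibre_measurable (S : finType) (H : T -> S) (Q : S -> Prop) :
  (forall s, measurable [set w | H w = s]) -> measurable [set w | Q (H w)].
Proof.
move=> mH.
rewrite (_ : [set w | _] = \bigcup_(s in [set s | Q s]) [set w | H w = s]).
  by apply: fin_bigcup_measurable => //; exact: finite_finset.
by apply/seteqP; split => w /=; [move=> QHw; exists (H w)|case=> s /= Qs ->].
Qed.

Lemma prob_total (S : finType) (H : T -> S) (E : set T) :
  (forall s, measurable (E `&` [set w | H w = s])) ->
  pr E = \sum_s pr (E `&` [set w | H w = s]).
Proof.
move=> mE.
have UE : E = \bigcup_(s in [set` index_enum S]) (E `&` [set w | H w = s]).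
  apply/seteqP; split => w /=.
    by move=> Ew; exists (H w) => //=; rewrite mem_index_enum.
  by case=> s _ [].
have fS : finite_set [set` index_enum S] by exact: finite_finset.
have mUE : measurable E by rewrite UE; apply: fin_bigcup_measurable.
apply: EFin_inj; rewrite -prE // {1}UE measure_fin_bigcup //; last first.
  by move=> i j _ _ [w [[_ /= <-] [_ /= <-]]].
rewrite -fsbig_seq ?index_enum_uniq // -sumEFin.
by apply: eq_bigr => s _; exact: prE.
Qed.

Context (S : finType) (init : S -> R) (K : S -> S -> R) (X : nat -> T -> S).
Hypothesis hX : markov_chain P init K X.

Let mX t s : measurable [set w | X t w = s]. Proof. by case: hX. Qed.

Context (A : pred S).

Let stay n := [set w | forall i, (i < n)%N -> A (X i w)].

Let occ n s := pr (stay n `&` [set w | X n w = s]).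

Lemma bounded_forall_measurable n (Q : nat -> S -> Prop) :
  measurable [set w | forall i, (i < n)%N -> Q i (X i w)].
Proof.
rewrite (_ : [set w | _] = \bigcap_(i in `I_n) [set w | Q i (X i w)]).
  by apply: fin_bigcap_measurable => // i _; exact: fin_fibre_measurable (mX i).
by apply/seteqP; split.
Qed.

Let measurable_stay n : measurable (stay n).
Proof. exact: (@bounded_forall_measurable n (fun _ s => A s)). Qed.

(** Histories are packed as finite functions: they then form a finite type, over which [prob_total]
    can sum. *)
Let path n (x : {ffun 'I_n.+1 -> S}) := [set w | [ffun i : 'I_n.+1 => X i w] = x].

Let pathE n (x : {ffun 'I_n.+1 -> S}) :
  path x = [set w | forall i : 'I_n.+1, X i w = x i].
Proof.
apply/seteqP; split => w /=; first by move=> <- i; rewrite ffunE.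
by move=> h; apply/ffunP => i; rewrite ffunE.
Qed.

Let measurable_path n (x : {ffun 'I_n.+1 -> S}) : measurable (path x).
Proof.
rewrite pathE (_ : [set w | _] =
    \bigcap_(i in setT) [set w | X (i : 'I_n.+1) w = x i]).
  by apply: fin_bigcap_measurable => //; exact: finite_finset.
by apply/seteqP; split => w /= h i; have := h i; [|apply].
Qed.

Let path_step n (x : {ffun 'I_n.+1 -> S}) s :
  pr (path x `&` [set w | X n.+1 w = s]) = pr (path x) * K (x ord_max) s.
Proof.
case: hX => _ _ /(_ n (fun i => if (i <= n)%N then x (inord i) else s)).
rewrite leqnn ltnn.
have -> : [set w | forall i, (i <= n.+1)%N ->
    X i w = (if (i <= n)%N then x (inord i) else s)] =
    path x `&` [set w | X n.+1 w = s].
  rewrite pathE; apply/seteqP; split => w /=.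
    move=> h; split=> [i|]; last by rewrite h // ltnn.
    by rewrite h ?(leqW (leq_ord i)) // leq_ord inord_val.
  move=> [h1 h2] i; rewrite leq_eqVlt => /orP[/eqP ->|]; first by rewrite ltnn.
  by rewrite ltnS => lein; rewrite lein -h1 inordK.
have -> : [set w | forall i, (i <= n)%N ->
    X i w = (if (i <= n)%N then x (inord i) else s)] = path x.
  rewrite pathE; apply/seteqP; split => w /=.
    by move=> h i; rewrite h leq_ord // inord_val.
  by move=> h i lein; rewrite lein -h inordK.
have -> : x (inord n) = x ord_max.
  by congr (x _); apply: val_inj; rewrite /= inordK.
rewrite prE; last exact: measurableI.
by rewrite prE // => -[].
Qed.

(* The Markov property, which is given for single paths, for the event of not
   having left [A]. *)
Let occ_step n s' : occ n.+1 s' = \sum_(s | A s) occ n s * K s s'.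
Proof.
pose ok m (x : {ffun 'I_n.+1 -> S}) := [forall i : 'I_n.+1, (i < m)%N ==> A (x i)].
have okP m x w : (m <= n.+1)%N -> path x w -> (ok m x <-> stay m w).
  rewrite pathE /= => lemn hw; split.
    by move/forallP => h i im; have := h (Ordinal (leq_trans im lemn));
      rewrite /= im /= -hw.
  by move=> h; apply/forallP => i; apply/implyP => im; rewrite -hw; exact: h.
have -> : occ n.+1 s' = \sum_(x | ok n.+1 x) pr (path x) * K (x ord_max) s'.
  rewrite /occ (prob_total (H := fun w => [ffun i : 'I_n.+1 => X i w])); last first.
    move=> x; apply: measurableI; [exact: measurableI|exact: measurable_path].
  rewrite (bigID (ok n.+1)) /= [X in _ + X]big1 ?addr0; last first.
    move=> x /negP nok; rewrite (_ : _ `&` _ = classical_sets.set0) ?/pr ?measure0 //.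
    apply/seteqP; split => // w [[hs _] hp]; apply: nok.
    by apply/(okP _ _ w) => //; exact: leqnSn.
  apply: eq_bigr => x okx; rewrite -path_step; congr pr.
  apply/seteqP; split => w [].
    by move=> [_ h] hp; split.
  by move=> hp h; split => //; split => //; exact: (okP _ _ _ (leqnn _) hp).1.
(* The histories are grouped by their last state [s]: [ok n.+1] splits into [A s] and [ok n], so
   each group adds up to [occ n s]. *)
rewrite (partition_big (fun x : {ffun 'I_n.+1 -> S} => x ord_max) A) /=; last first.
  by move=> x /forallP/(_ ord_max)/implyP; apply; exact: ltnSn.
apply: eq_bigr => s As; rewrite /occ.
rewrite (prob_total (H := fun w => [ffun i : 'I_n.+1 => X i w])); last first.
  by move=> x; apply: measurableI; [exact: measurableI|exact: measurable_path].
rewrite mulr_suml [RHS](bigID (fun x => ok n x && (x ord_max == s))) /=.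
rewrite [X in _ + X]big1 ?addr0; last first.
  move=> x /negP nok; rewrite (_ : _ `&` _ = classical_sets.set0) ?/pr ?measure0 ?mul0r //.
  apply/seteqP; split => // w [[hs hn] hp]; apply: nok; apply/andP; split.
    by apply/(okP _ _ w) => //; exact: leqnSn.
  by move: hp; rewrite -[[set _ | _]]/(path x) pathE => /= <-; apply/eqP.
apply: eq_big => x.
  case: (eqVneq (x ord_max) s) => [xs|]; rewrite ?andbF // !andbT.
  apply/forallP/forallP => h i; apply/implyP => im.
    by have /implyP := h i; apply; exact: ltnW.
  have [->|ni] := eqVneq i ord_max; first by rewrite xs.
  have /implyP := h i; apply; rewrite ltn_neqAle -ltnS im andbT.
  by apply: contra ni => /eqP e; apply/eqP/val_inj.
move=> /andP[/forallP okx /eqP xs]; rewrite xs; congr (pr _ * _).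
have okn : ok n x.
  by apply/forallP => i; apply/implyP => im; have /implyP := okx i; apply; exact: ltnW.
apply/seteqP; split => w; last by case.
move=> hp; split => //; split.
  exact: (okP _ _ _ (leqnSn _) hp).1 okn.
by move: hp; rewrite pathE => /(_ ord_max) /= ->.
Qed.

(** An exit bound by mass accounting: [occ t] is the law at time [t] of the paths that had not left
    [A] before [t]. The [V]-mass of this law does not grow, and every path leaving [A] outside [G],
    or still in [A] at time [n], takes away at least its own probability. *)
Lemma supermartingale_exit_bound (G : pred S) (V : nat -> S -> R) (n : nat)
    (E : set T) :
  (forall t s, 0 <= V t s) ->
  (forall t s, (t < n)%N -> A s -> \sum_s' K s s' * V t.+1 s' <= V t s) ->
  (forall t s, (t <= n)%N -> ~~ A s -> ~~ G s -> 1 <= V t s) ->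
  (forall s, A s -> 1 <= V n s) ->
  measurable E ->
  (forall w t, (t <= n)%N -> (forall i, (i < t)%N -> A (X i w)) ->
    ~~ A (X t w) -> G (X t w) -> E w) ->
  ((1 - \sum_s init s * V 0%N s)%:E <= P E)%E.
Proof.
move=> V0 VK Vbad Vend mE goodE.
pose B s := ~~ A s && ~~ G s.
pose bad t := stay t `&` [set w | B (X t w)].
have mbad t : measurable (bad t).
  by apply: measurableI => //; exact: (fin_fibre_measurable (fun s => B s) (mX t)).
have occ_ge0 t s : 0 <= occ t s by rewrite fine_ge0.
have occ_sum t (Q : pred S) :
    pr (stay t `&` [set w | Q (X t w)]) = \sum_(s | Q s) occ t s.
  rewrite (prob_total (H := X t)); last first.
    move=> s; apply: measurableI => //; apply: measurableI => //.
    exact: (fin_fibre_measurable (fun s => Q s) (mX t)).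
  rewrite (bigID Q) /= [X in _ + X]big1 ?addr0; last first.
    move=> s /negP nQs; rewrite (_ : _ `&` _ = classical_sets.set0) ?/pr ?measure0 //.
    by apply/seteqP; split => // w [[_ /= Qw] /= ws]; apply: nQs; rewrite -ws.
  apply: eq_bigr => s Qs; congr pr; apply/seteqP; split => w.
    by move=> [[]].
  by move=> [hs /= ws]; split => //; split => //=; rewrite ws.
have occ0 s : occ 0%N s = init s.
  apply: EFin_inj; rewrite -prE; last exact: measurableI.
  case: (hX) => _ <- _; congr (P _); apply/seteqP; split => w; first by case.
  by split.
(* Invariant: the mass already lost to bad exits plus the current [V]-mass is at most the initial
   [V]-mass. *)
have main m : (m <= n)%N -> \sum_(t < m) \sum_(s | B s) occ t s +
    \sum_s occ m s * V m s <= \sum_s init s * V 0%N s.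
  elim: m => [_|m IH ltmn].
    by rewrite big_ord0 add0r; apply: ler_sum => s _; rewrite occ0.
  apply: le_trans (IH (ltnW ltmn)).
  rewrite big_ord_recr /= -addrA lerD2l.
  under [X in _ + X]eq_bigr => s' _ do rewrite occ_step mulr_suml.
  rewrite exchange_big /= [leRHS](bigID A) /= addrC; apply: lerD.
    apply: ler_sum => s As.
    under eq_bigr => s' _ do rewrite -mulrA.
    by rewrite -mulr_sumr ler_wpM2l // VK.
  rewrite [leRHS](bigID (fun s => ~~ G s)) /= -[leLHS]addr0; apply: lerD.
    apply: ler_sum => s /andP[nA nG]; rewrite ler_peMr //.
    by apply: Vbad => //; exact: ltnW.
  by apply: sumr_ge0 => s _; rewrite mulr_ge0.
(* Off [E], a path has a first exit at some [t <= n], which is bad, or stays in [A] through time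
   [n]; the index [n.+1] stands for the latter case. *)
pose F t := if (t <= n)%N then bad t else stay n.+1.
have mF t : measurable (F t) by rewrite /F; case: ifP.
have subF : ~` E `<=` \big[setU/classical_sets.set0]_(k < n.+2) F k.
  move=> w nEw; rewrite -bigcup_mkord.
  have [/forallP all_A|] := boolP [forall i : 'I_n.+1, A (X i w)].
    exists n.+1 => //=; rewrite /F ltnn => i ltin.
    exact: (all_A (Ordinal ltin)).
  rewrite negb_forall => /existsP[i0 nAi0].
  have exi : exists i, ~~ A (X i w) by exists i0.
  case: (ex_minnP exi) => i nAi mini.
  have lein : (i <= n)%N by apply: leq_trans (mini _ nAi0) _; rewrite -ltnS.
  exists i; first by rewrite /= ltnS (leq_trans lein).
  rewrite /F lein; split => [j ltji|] /=.
    by apply/negPn/negP => nAj; have := mini _ nAj; rewrite leqNgt ltji.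
  rewrite /B nAi /=; apply/negP => Gi; apply: nEw; apply: (goodE w i) => // j ltji.
  by apply/negPn/negP => nAj; have := mini _ nAj; rewrite leqNgt ltji.
have PE : (P (~` E) <= \sum_(k < n.+2) P (F k))%E.
  exact: content_subadditive (fun k _ => mF k) (measurableC mE) subF.
move: PE; rewrite probability_setC // (prE mE) => PE.
rewrite lee_fin lerBlDl -lerBlDr.
apply: le_trans (main n (leqnn n)).
move: PE; rewrite (eq_bigr (fun k : 'I_n.+2 => (pr (F k))%:E)); last by move=> k _; exact: prE.
rewrite sumEFin -EFinB lee_fin => /le_trans; apply.
rewrite big_ord_recr /= {2}/F ltnn big_ord_recr /= {2}/F leqnn -addrA; apply: lerD.
  apply: ler_sum => k _; rewrite /F ltnW // /bad.
  by rewrite occ_sum.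
have -> : stay n.+1 = stay n `&` [set w | A (X n w)].
  apply/seteqP; split => w /=.
    by move=> h; split => [i lti|]; apply: h; rewrite // ltnS ltnW.
  by move=> [h hn] i; rewrite ltnS leq_eqVlt => /orP[/eqP ->|/h].
rewrite !occ_sum addrC [leRHS](bigID A) /=; apply: lerD.
  by apply: ler_sum => s As; rewrite ler_peMr // Vend.
rewrite [leRHS](bigID (fun s => ~~ G s)) /= -[leLHS]addr0; apply: lerD.
  apply: ler_sum => s /andP[nA nG]; rewrite ler_peMr //.
  exact: Vbad.
by apply: sumr_ge0 => s _; rewrite mulr_ge0.
Qed.

End finite_state_chain.

(** * Discordant edges under a single update *)

Section discordant_pairs.
Context (N : nat).
Implicit Types (s : state N) (v u z w : 'I_N).

Definition dpair s v u := [set v; u]%SET \in discordant s.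

(** Targets [z != v] make the new edge set a simple graph; otherwise [insubd] falls back on the old
    graph, which makes [rewire] total. *)
Definition rewire s v u z : state N := (insubd s.1 (rewire_edges s v u z), s.2).

Definition ones s := #|[set v | s.2 v]%SET|.

Lemma card_edge (g : sgraph N) e : e \in val g -> #|e| = 2%N.
Proof. by move=> eg; have /forall_inP/(_ e eg)/eqP := valP g. Qed.

Lemma edge_neq (g : sgraph N) v u : [set v; u]%SET \in val g -> v != u.
Proof. by move=> /card_edge; rewrite cards2; case: eqP. Qed.

Lemma set2_inj v : injective (fun u => [set v; u]%SET).
Proof.
move=> u w /= e; have : w \in [set v; u]%SET by rewrite e !inE eqxx orbT.
have : u \in [set v; w]%SET by rewrite -e !inE eqxx orbT.
by rewrite !inE => /orP[/eqP->|/eqP->//] /orP[/eqP->|/eqP->].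
Qed.

Lemma dpairE s v u : dpair s v u = ([set v; u]%SET \in val s.1) && (s.2 v != s.2 u).
Proof.
rewrite /dpair inE; congr andb; apply/idP/idP.
  move=> /existsP[x /andP[xe /existsP[y /andP[ye]]]].
  move: xe ye; rewrite !inE => /orP[]/eqP-> /orP[]/eqP->; rewrite ?eqxx //.
  by rewrite eq_sym.
move=> vu; apply/existsP; exists v; rewrite !inE eqxx /=.
by apply/existsP; exists u; rewrite !inE eqxx orbT.
Qed.

Lemma dpair_sym s v u : dpair s v u = dpair s u v.
Proof. by rewrite /dpair finset.setUC. Qed.

Lemma discordant_pair s e : e \in discordant s ->
  exists v u, [/\ e = [set v; u]%SET, v != u & s.2 v && ~~ s.2 u].
Proof.
move=> eD; have := eD; rewrite inE => /andP[eg _].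
have /eqP/cards2P[v [u [vu ee]]] := card_edge eg.
have := eD; rewrite ee -/(dpair s v u) dpairE => /andP[_].
case sv: (s.2 v); case su: (s.2 u) => // _.
  by exists v, u; split; rewrite // sv su.
exists u, v; split; [by rewrite finset.setUC|by rewrite eq_sym|by rewrite su sv].
Qed.

(** Double counting: for fixed [v] the partners [u] correspond to the discordant edges through [v],
    and every edge has two ends. *)
Lemma sum_dpair s : (\sum_v \sum_(u | dpair s v u) 1 = 2 * #|discordant s|)%N.
Proof.
transitivity (\sum_(e in discordant s) #|e|)%N; last first.
  rewrite mulnC -sum_nat_const.
  by apply: eq_bigr => e; rewrite inE => /andP[/card_edge].
transitivity (\sum_v \sum_(e in discordant s | v \in e) 1)%N; last first.
  rewrite (exchange_big_dep (mem (discordant s))) /=; last by move=> v e _ /andP[].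
  apply: eq_bigr => e eD; rewrite -sum1_card; apply: eq_bigl => v.
  by rewrite eD.
apply: eq_bigr => v _; rewrite !sum1_card.
rewrite -(card_imset _ (@set2_inj v)); apply: eq_card => e.
apply/imsetP/idP => [[u vu ->]|].
  by apply/andP; split; [exact: vu|rewrite !inE eqxx].
move=> /andP[eD ve].
have [x [y [exy _ _]]] := discordant_pair eD.
move: ve; rewrite exy !inE => /orP[]/eqP ->.
  by exists y; rewrite // -topredE /= /dpair -exy.
by exists x; rewrite -?topredE /= /dpair finset.setUC -?exy.
Qed.

End discordant_pairs.

(** * Change of discordant edges, degrees and ones under a vote or a rewiring *)

Section updates.
Context (N : nat).
Implicit Types (s : state N) (v u z w : 'I_N).

Lemma discordantP s (e : {set 'I_N}) :
  reflect (e \in val s.1 /\ exists x y, [/\ x \in e, y \in e & s.2 x != s.2 y])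
          (e \in discordant s).
Proof.
rewrite [_ \in discordant s]inE; apply: (iffP andP) => -[eg].
  move=> /existsP[x /andP[xe /existsP[y /andP[ye xy]]]].
  by split => //; exists x, y.
case=> x [y [xe ye xy]]; split => //; apply/existsP; exists x; rewrite xe /=.
by apply/existsP; exists y; rewrite ye.
Qed.

(** Only edges through [v] can change status, and these are indexed by the neighbors of [v]. *)
Lemma card_discordant_vote s v u :
  (#|discordant (vote s v u)| <= #|discordant s| + #|neighbors s.1 v|)%N.
Proof.
apply: leq_trans (leq_add (leqnn _) (leq_imset_card (fun w => [set v; w]%SET) _)).
apply: leq_trans (leq_card_setU _ _).
apply: subset_leq_card; apply/fintype.subsetP => e /discordantP[/= eg [x [y [xe ye]]]].
rewrite !ffunE finset.in_setU => xy; apply/orP.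
have [ve|nve] := boolP (v \in e); last first.
  left; apply/discordantP; split => //; exists x, y; split => //.
  by move: xy; rewrite !ifN //; [apply: contraNN nve => /eqP<-|
    apply: contraNN nve => /eqP<-].
right; apply/imsetP.
have /eqP/cards2P[a [b [ab ee]]] := card_edge eg.
move: ve; rewrite ee !inE => /orP[]/eqP->.
  by exists b => //; rewrite inE -ee.
by exists a; rewrite ?inE finset.setUC // -ee.
Qed.

Lemma rewire_edgesE s v u z : z \in rewire_targets s v ->
  val (rewire s v u z).1 = rewire_edges s v u z.
Proof.
rewrite inE => /andP[zv _]; apply: insubdK.
apply/forall_inP => e; rewrite !inE => /orP[/eqP->|/andP[_ /card_edge->//]].
by rewrite cards2 [v == z]eq_sym zv.
Qed.

(** The discordant edge from [v] to [u] disappears, and the only possible new one joins [v] to [z].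
    Adding 1 on the left avoids truncated subtraction. *)
Lemma card_discordant_rewire s v u z :
    dpair s v u -> z \in rewire_targets s v ->
  (#|discordant (rewire s v u z)| + 1 <= #|discordant s| + (s.2 z != s.2 v))%N.
Proof.
move=> vu ztg; rewrite (cardsD1 [set v; u]%SET (discordant s)) [_ \in _]vu.
rewrite -addnA addnC leq_add2l.
pose new := if s.2 z != s.2 v then [set [set v; z]]%SET else finset.set0.
have -> : (s.2 z != s.2 v : nat) = #|new|.
  by rewrite /new; case: ifP => _; rewrite ?cards1 ?cards0.
apply: leq_trans (leq_card_setU _ _).
apply: subset_leq_card; apply/fintype.subsetP => e /discordantP[].
rewrite rewire_edgesE // /= => eg [x [y [xe ye xy]]].
rewrite finset.in_setU; apply/orP.
move: eg; rewrite finset.in_setU1 => /orP[/eqP ee|]; last first.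
  rewrite finset.in_setD1 => /andP[evu eg]; left; rewrite finset.in_setD1 evu.
  by apply/discordantP; split => //; exists x, y.
right; rewrite /new.
suff -> : s.2 z != s.2 v by rewrite finset.in_set1 ee.
move: xe ye xy; rewrite ee !inE => /orP[]/eqP-> /orP[]/eqP->; rewrite ?eqxx //.
by rewrite eq_sym.
Qed.

(** The root [v] exchanges [u] for [z], so its degree does not grow; among the other vertices only
    [z] receives an edge. *)
Lemma degree_rewire s v u z w :
    [set v; u]%SET \in val s.1 -> z \in rewire_targets s v ->
  (#|neighbors (rewire s v u z).1 w| <= #|neighbors s.1 w| + (w == z))%N.
Proof.
move=> vu ztg; have /edge_neq vNu := vu.
have zv : z != v by move: ztg; rewrite inE => /andP[].
have [wv|wv] := eqVneq w v.
  subst w; rewrite eq_sym (negbTE zv) addn0.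
  have uv : u \in neighbors s.1 v by rewrite inE.
  rewrite (cardsD1 u (neighbors s.1 v)) uv.
  apply: leq_trans (_ : #|z |: (neighbors s.1 v :\ u)|%SET <= _)%N; last first.
    by rewrite cardsU1 leq_add2r leq_b1.
  apply: subset_leq_card; apply/fintype.subsetP => x.
  rewrite inE rewire_edgesE // finset.in_setU1 finset.in_setD1.
  rewrite finset.in_setU1 finset.in_setD1 inE => /orP[/eqP/set2_inj->|/andP[xu ->]].
    by rewrite eqxx.
  rewrite andbT; apply/orP; right; apply: contra xu => /eqP->.
  by [].
have [wz|wz] := eqVneq w z.
  subst w; rewrite addn1.
  apply: leq_trans (_ : #|v |: neighbors s.1 z|%SET <= _)%N; last first.
    by rewrite cardsU1 -add1n leq_add2r leq_b1.
  apply: subset_leq_card; apply/fintype.subsetP => x.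
  rewrite inE rewire_edgesE // finset.in_setU1 finset.in_setD1.
  rewrite finset.in_setU1 inE => /orP[/eqP|/andP[_ ->]]; last by rewrite orbT.
  by rewrite [RHS]finset.setUC => /set2_inj->; rewrite eqxx.
rewrite addn0; apply: subset_leq_card; apply/fintype.subsetP => x.
rewrite inE rewire_edgesE // finset.in_setU1 finset.in_setD1 inE.
move=> /orP[/eqP e|/andP[_ //]].
have : w \in [set v; z]%SET by rewrite -e !inE eqxx.
by rewrite !inE (negbTE wv) (negbTE wz).
Qed.

Lemma card_rewire_targets s v :
  (#|rewire_targets s v| + (#|neighbors s.1 v| + 1))%N = N.
Proof.
have -> : (#|neighbors s.1 v| + 1)%N = #|(v |: neighbors s.1 v)%SET|.
  by rewrite cardsU1 addnC inE; case: (boolP (_ \in _)) => // /edge_neq; rewrite eqxx.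
rewrite -[RHS]card_ord -(cardsC (v |: neighbors s.1 v)%SET) addnC; congr addn.
by apply: eq_card => z; rewrite !inE negb_or.
Qed.

Lemma card_rewire_targets_ge s (M : nat) v :
  (forall w, #|neighbors s.1 w| <= M)%N -> (N - M.+1 <= #|rewire_targets s v|)%N.
Proof. by move=> degM; have := card_rewire_targets s v; have := degM v; lia. Qed.

Lemma rewire_targets_neq0 s (M : nat) v : (M.+1 < N)%N ->
  (forall w, #|neighbors s.1 w| <= M)%N -> rewire_targets s v != finset.set0.
Proof.
by move=> ltMN /(card_rewire_targets_ge v); rewrite -card_gt0; lia.
Qed.

Lemma onesE s : ones s = (\sum_w s.2 w)%N.
Proof.
by rewrite /ones -sum1_card big_mkcond; apply: eq_bigr => w _; rewrite inE; case: (s.2 w).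
Qed.

Lemma ones_vote s v u : (ones (vote s v u) + s.2 v = ones s + s.2 u)%N.
Proof.
rewrite !onesE (bigD1 v) //= [in RHS](bigD1 v) //= ffunE eqxx.
rewrite (eq_bigr (fun w => s.2 w : nat)); first by rewrite addnC addnCA -addnA addnC -addnA.
by move=> w /negbTE wv; rewrite ffunE wv.
Qed.

(** Each discordant edge is charged to its end of opinion 1. Initially this reduces the control of
    discordant edges to that of the number of ones. *)
Lemma card_discordant_le s (k : nat) :
  regular k s.1 -> (#|discordant s| <= k * ones s)%N.
Proof.
move=> /forallP reg.
apply: leq_trans (_ : #|\bigcup_(v | s.2 v) [set [set v; u]%SET | u in neighbors s.1 v]|%SET
   <= _)%N.
  apply: subset_leq_card; apply/fintype.subsetP => e eD.
  have [v [u [ee vu /andP[sv _]]]] := discordant_pair eD.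
  apply/finset.bigcupP; exists v => //; apply/imsetP; exists u => //.
  by rewrite inE -ee; move: eD; rewrite inE => /andP[].
have -> : (k * ones s)%N = (\sum_(v | s.2 v) k)%N.
  by rewrite sum_nat_const mulnC; congr (_ * _)%N; apply: eq_card => v; rewrite !inE.
elim/big_ind2: _ => [|A a B b Aa Bb|v sv]; first by rewrite cards0.
  exact: leq_trans (leq_card_setU _ _) (leq_add Aa Bb).
by apply: leq_trans (leq_imset_card _ _) _; rewrite (eqP (reg v)).
Qed.

End updates.

(** * One-step estimates for the potentials *)

Section discordant_average.
Context (R : realType) (N : nat) (s : state N).
Implicit Types (v u z : 'I_N).

Definition davg (F : 'I_N -> 'I_N -> R) : R :=
  \sum_v \sum_(u | dpair s v u) (#|discordant s|%:R^-1 * 2^-1) * F v u.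

Definition target_avg v (F : 'I_N -> R) : R :=
  \sum_(z in rewire_targets s v) #|rewire_targets s v|%:R^-1 * F z.

(** Both orientations of an edge have equal weight. This symmetry cancels the mean change of [ones]
    and balances the opinions of the roots. *)
Lemma davg_sym F : davg F = davg (fun v u => F u v).
Proof.
rewrite /davg (exchange_big_dep xpredT) //=.
by apply: eq_bigr => u _; apply: eq_bigl => v; rewrite dpair_sym.
Qed.

Lemma davg_le F G :
  (forall v u, dpair s v u -> F v u <= G v u) -> davg F <= davg G.
Proof.
move=> FG; apply: ler_sum => v _; apply: ler_sum => u vu.
by rewrite ler_wpM2l ?FG // mulr_ge0 ?invr_ge0.
Qed.

Lemma davgD F G : davg (fun v u => F v u + G v u) = davg F + davg G.
Proof.
rewrite /davg -big_split; apply: eq_bigr => v _; rewrite -big_split.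
by apply: eq_bigr => u _; rewrite mulrDr.
Qed.

Lemma davgZ c F : davg (fun v u => c * F v u) = c * davg F.
Proof.
rewrite /davg mulr_sumr; apply: eq_bigr => v _; rewrite mulr_sumr.
by apply: eq_bigr => u _; rewrite mulrCA.
Qed.

Lemma davg_cst c : discordant s != finset.set0 -> davg (fun _ _ => c) = c.
Proof.
rewrite -card_gt0 => D0; have D0' : #|discordant s|%:R != 0 :> R by rewrite pnatr_eq0 -lt0n.
pose w : R := #|discordant s|%:R^-1 * 2^-1 * c.
transitivity ((\sum_v \sum_(u | dpair s v u) 1)%N%:R * w).
  rewrite natr_sum mulr_suml; apply: eq_bigr => v _.
  by rewrite natr_sum mulr_suml; apply: eq_bigr => u _; rewrite mul1r.
by rewrite sum_dpair natrM /w; field.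
Qed.

Lemma target_avg_cst v c : rewire_targets s v != finset.set0 ->
  target_avg v (fun=> c) = c.
Proof.
rewrite -card_gt0 => t0; rewrite /target_avg sumr_const -[LHS]mulr_natl mulrA mulfV ?mul1r //.
by rewrite pnatr_eq0 -lt0n.
Qed.

Lemma target_avg_le v F G :
  (forall z, z \in rewire_targets s v -> F z <= G z) ->
  target_avg v F <= target_avg v G.
Proof. by move=> FG; apply: ler_sum => z zt; rewrite ler_wpM2l ?invr_ge0 ?FG. Qed.

Lemma target_avgD v F G :
  target_avg v (fun z => F z + G z) = target_avg v F + target_avg v G.
Proof. by rewrite /target_avg -big_split; apply: eq_bigr => z _; rewrite mulrDr. Qed.

Lemma target_avgZ v c F :
  target_avg v (fun z => c * F z) = c * target_avg v F.
Proof. by rewrite /target_avg mulr_sumr; apply: eq_bigr => z _; rewrite mulrCA. Qed.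

Lemma rewire_prob_sum v u (f : state N -> R) :
    rewire_targets s v != finset.set0 ->
  \sum_s' rewire_prob R s v u s' * f s' = target_avg v (fun z => f (rewire s v u z)).
Proof.
move=> /negbTE t0; rewrite /rewire_prob t0.
under eq_bigr => s' _ do rewrite mulr_suml.
rewrite exchange_big; apply: eq_bigr => z zt /=.
under eq_bigr => s' _ do rewrite -mulrA.
rewrite -mulr_sumr; congr (_ * _).
rewrite (bigD1 (rewire s v u z)) //= rewire_edgesE // !eqxx mul1r.
rewrite big1 ?addr0 // => s' ns'.
case: andP => [[/eqP h1 /eqP h2]|_]; last by rewrite mul0r.
case/eqP: ns'; rewrite [s']surjective_pairing h2 [RHS]surjective_pairing /=.
congr (_, _); apply: val_inj; exact: etrans h1 (esym (rewire_edgesE u zt)).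
Qed.

(** The hypotheses exclude the absorbing branch of the kernel and the branch without a rewiring
    target; what remains is an average over orientations and targets. *)
Lemma evoter_trans_sum (nu : R) (L : nat) (f : state N -> R) :
    discordant s != finset.set0 ->
    (forall v, rewire_targets s v != finset.set0) ->
  \sum_s' evoter_trans nu L s s' * f s' =
  davg (fun v u => nu / L%:R * f (vote s v u) +
    (1 - nu / L%:R) * target_avg v (fun z => f (rewire s v u z))).
Proof.
move=> /negbTE D0 t0; rewrite /evoter_trans D0.
under eq_bigr => s' _ do rewrite mulr_suml.
rewrite exchange_big; apply: eq_bigr => v _ /=.
under eq_bigr => s' _ do rewrite mulr_suml.
rewrite exchange_big; apply: eq_bigr => u vu /=.
under eq_bigr => s' _ do rewrite -[_ / 2 * _ * _]mulrA.
rewrite -mulr_sumr; congr (_ * _).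
under eq_bigr => s' _ do rewrite mulrDl -[_ / _ * _ * _]mulrA -[(1 - _) * _ * _]mulrA.
rewrite big_split /= -!mulr_sumr rewire_prob_sum //; congr (_ * _ + _).
rewrite (bigD1 (vote s v u)) //= eqxx mul1r big1 ?addr0 // => s' /negbTE->.
by rewrite mul0r.
Qed.

End discordant_average.

(** * Mean change of the three potentials in one update *)

Section one_step_bounds.
Context (R : realType) (N L M : nat) (nu : R) (s : state N).
Implicit Types (v u z w : 'I_N).
Hypothesis nuL : 0 <= nu / L%:R <= 1.
Hypothesis ltMN : (M.+1 < N)%N.
Hypothesis degM : forall v, (#|neighbors s.1 v| <= M)%N.
Hypothesis disc : discordant s != finset.set0.

(** Bounds the chance that a given vertex is the rewiring target: the root and its at most [M]
    neighbors are excluded. *)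
Let q : R := (N - M.+1)%:R^-1.

Let card_targets_ge v := card_rewire_targets_ge v degM.

Let targets_neq0 v := rewire_targets_neq0 v ltMN degM.

Let target_avg_le_sum v (F : 'I_N -> R) : (forall z, 0 <= F z) ->
  target_avg s v F <= q * \sum_z F z.
Proof.
move=> F0; rewrite mulr_sumr /target_avg big_mkcond; apply: ler_sum => z _.
case: ifP => _; last by rewrite mulr_ge0 ?invr_ge0.
rewrite ler_wpM2r // lef_pV2 ?posrE ?ltr0n ?ler_nat //.
- by have := card_targets_ge v; lia.
- by lia.
Qed.

(** An exponential moment summed over vertices: a single degree above [M] already contributes
    [(1 + th) ^+ M.+1]. *)
Definition degree_potential (th : R) (s' : state N) : R :=
  \sum_w (1 + th) ^+ #|neighbors s'.1 w|.

(** A vote keeps the graph. A rewiring adds at most [th] times the weight of the target, and each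
    vertex is the target with chance at most [q]. *)
Lemma degree_potential_step (th : R) : 0 <= th ->
  \sum_s' evoter_trans nu L s s' * degree_potential th s' <=
  (1 + q * th) * degree_potential th s.
Proof.
move=> th0; have [r0 r1] := andP nuL.
have th1 : 1 <= 1 + th by rewrite lerDl.
have pow0 n : 0 <= (1 + th) ^+ n by rewrite exprn_ge0 // (le_trans ler01).
set p := degree_potential th s.
have p0 : 0 <= p by apply: sumr_ge0.
have q0 : 0 <= q by rewrite invr_ge0.
rewrite evoter_trans_sum // -[leRHS](davg_cst _ disc).
apply: davg_le => v u; rewrite dpairE => /andP[vu _].
rewrite {1}/degree_potential /= -/(degree_potential th s) -/p.
have : target_avg s v (fun z => degree_potential th (rewire s v u z)) <=
    (1 + q * th) * p.
  apply: le_trans (_ : target_avg s v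
      (fun z => p + th * (1 + th) ^+ #|neighbors s.1 z|) <= _).
    apply: target_avg_le => z zt.
    rewrite /p /degree_potential (bigD1 z) //= [X in _ <= X + _](bigD1 z) //=.
    rewrite -addrA [X in _ <= _ + X]addrC addrA; apply: lerD.
      rewrite -[X in _ <= X + _]mul1r -mulrDl -exprS ler_weXn2l //.
      by have := degree_rewire z vu zt; rewrite eqxx addn1.
    apply: ler_sum => w /negbTE wz; rewrite ler_weXn2l //.
    by have := degree_rewire w vu zt; rewrite wz addn0.
  rewrite target_avgD target_avg_cst // mulrDl mul1r lerD2l target_avgZ.
  rewrite [q * th]mulrC -mulrA ler_wpM2l //.
  exact: target_avg_le_sum.
move=> h; apply: le_trans (_ : nu / L%:R * ((1 + q * th) * p) +
  (1 - nu / L%:R) * ((1 + q * th) * p) <= _); last by rewrite -mulrDl addrC subrK mul1r.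
apply: lerD; apply: ler_wpM2l => //; last by rewrite subr_ge0.
by rewrite mulrDl mul1r lerDl !mulr_ge0.
Qed.

(** A vote moves [ones] by one, up or down with equal chance by [davg_sym], so the cross term
    vanishes; the squared jump has mean [nu / L]. *)
Lemma ones_step (m : R) :
  \sum_s' evoter_trans nu L s s' * ((ones s')%:R - m) ^+ 2 <=
  ((ones s)%:R - m) ^+ 2 + nu / L%:R.
Proof.
set x := (ones s)%:R - m; set r := nu / L%:R.
pose dif v u : R := (s.2 u)%:R - (s.2 v)%:R.
rewrite evoter_trans_sum //.
apply: le_trans (_ : davg s (fun v u => x ^+ 2 + r +
  2 * r * x * dif v u) <= _); last first.
  rewrite davgD davg_cst // davgZ.
  have : davg s dif + davg s dif = 0.
    rewrite {1}davg_sym -davgD -[RHS](davg_cst _ disc).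
    by congr davg; apply/funext => v; apply/funext => u; rewrite /dif; ring.
  move=> sum0; have -> : davg s dif = 0 by lra.
  by rewrite mulr0 addr0.
apply: davg_le => v u; rewrite dpairE => /andP[_ svu].
have -> : (ones (vote s v u))%:R - m = x + dif v u.
  have /(congr1 (fun n => n%:R : R)) := ones_vote s v u.
  by rewrite !natrD /x /dif; lra.
have -> : (fun z => ((ones (rewire s v u z))%:R - m) ^+ 2) = fun=> x ^+ 2 by [].
rewrite target_avg_cst //.
rewrite /dif; move: svu.
by case: (s.2 v); case: (s.2 u) => //= _; rewrite le_eqVlt; apply/orP;
  left; apply/eqP; rewrite -/r; ring.
Qed.

Definition pos_sqr (y : R) : R := Num.max y 0 ^+ 2.

Lemma pos_sqr_ge0 y : 0 <= pos_sqr y. Proof. exact: sqr_ge0. Qed.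

(* Squaring the positive part only requires an upper bound on the increment: a
   large downward move never hurts. *)
Lemma pos_sqr_le (y y' del : R) : y' <= y + del ->
  pos_sqr y' <= pos_sqr y + 2 * Num.max y 0 * del + del ^+ 2.
Proof.
rewrite /pos_sqr => h.
case: (leP y 0) => hy; case: (leP y' 0) => hy'.
- by rewrite mulr0 mul0r addr0 lerDl sqr_ge0.
- by rewrite mulr0 mul0r expr0n add0r add0r ler_sqr ?nnegrE; lra.
- rewrite expr0n /= (_ : _ + _ = (y + del) ^+ 2) ?sqr_ge0 //; ring.
- by rewrite (_ : _ + del ^+ 2 = (y + del) ^+ 2) ?ler_sqr ?nnegrE; [|lra|lra|ring].
Qed.

(* [c] is the guaranteed downward speed; the hypothesis on [nu], [c] and [M]
   bounds the mean increment compensated by [c], the two opinions of a discordant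
   pair sharing the [N] possible targets. *)
Lemma discordant_step (c b : R) : 0 <= c <= 1 ->
  nu / L%:R * (M%:R + c) + (1 - nu / L%:R) * (c - 1 + q * N%:R / 2) <= 0 ->
  \sum_s' evoter_trans nu L s s' * pos_sqr (#|discordant s'|%:R + c + b) <=
  pos_sqr (#|discordant s|%:R + b) + (nu / L%:R * (M%:R + c) ^+ 2 + 1).
Proof.
move=> /andP[c0 c1]; have [r0 r1] := andP nuL.
set r := nu / L%:R => drift.
set y := #|discordant s|%:R + b; set y0 := Num.max y 0.
have y0_ge0 : 0 <= y0 by rewrite le_max lexx orbT.
have q0 : 0 <= q by rewrite invr_ge0.
pose opp v : R := \sum_z (s.2 z != s.2 v)%:R.
rewrite evoter_trans_sum //.
apply: le_trans (_ : davg s (fun v u => (pos_sqr y + (r * (M%:R + c) ^+ 2 + 1) +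
  2 * y0 * (r * (M%:R + c) + (1 - r) * (c - 1))) +
  2 * y0 * (1 - r) * q * opp v) <= _); last first.
  rewrite davgD davg_cst // davgZ.
  (* Every vertex [z] disagrees with exactly one end of a discordant pair, so [opp v] and [opp u]
     add up to [N]; by symmetry each averages to half of it. *)
  have -> : davg s (fun v u => opp v) = N%:R / 2.
    have sym : davg s (fun v u => opp v) = davg s (fun v u => opp u).
      by rewrite davg_sym.
    have : davg s (fun v u => opp v) + davg s (fun v u => opp u) = N%:R.
      rewrite -davgD -[RHS](davg_cst _ disc).
      rewrite /davg; apply: eq_bigr => v _; apply: eq_bigr => u.
      rewrite dpairE => /andP[_ svu]; congr (_ * _).
      rewrite /opp -big_split /= (eq_bigr (fun=> 1)) ?sumr_const ?card_ord //.
      by move=> z _; move: svu; case: (s.2 v); case: (s.2 u); case: (s.2 z) => //=;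
        rewrite ?addr0 ?add0r.
    by rewrite -sym; lra.
  rewrite -addrA gerDl.
  have -> : 2 * y0 * (r * (M%:R + c) + (1 - r) * (c - 1)) +
     2 * y0 * (1 - r) * q * (N%:R / 2) = 2 * y0 *
     (r * (M%:R + c) + (1 - r) * (c - 1 + q * N%:R / 2)) by field.
  by rewrite mulr_ge0_le0 // mulr_ge0.
apply: davg_le => v u vu.
have hv : pos_sqr (#|discordant (vote s v u)|%:R + c + b) <=
    pos_sqr y + 2 * y0 * (M%:R + c) + (M%:R + c) ^+ 2.
  apply: pos_sqr_le; rewrite /y.
  have : (#|discordant (vote s v u)| <= #|discordant s| + M)%N.
    by apply: leq_trans (card_discordant_vote _ _ _) _; rewrite leq_add2l.
  by rewrite -(ler_nat R) natrD; lra.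
have hr : target_avg s v (fun z => pos_sqr (#|discordant (rewire s v u z)|%:R + c + b))
    <= pos_sqr y + 1 + 2 * y0 * (c - 1) + 2 * y0 * (q * opp v).
  apply: le_trans (_ : target_avg s v (fun z => (pos_sqr y + 1 + 2 * y0 * (c - 1)) +
     2 * y0 * (s.2 z != s.2 v)%:R) <= _).
    apply: target_avg_le => z zt.
    have := card_discordant_rewire vu zt.
    rewrite -(ler_nat R) !natrD => hD.
    apply: le_trans (pos_sqr_le (y := y) (del := c - 1 + (s.2 z != s.2 v)%:R) _) _.
      by rewrite /y; lra.
    (* The increment is [c - 1] or [c], so its square is at most 1 because [c] lies in the unit
       interval. *)
    by rewrite -/y0; case: (s.2 z != s.2 v) => /=; nra.
  rewrite target_avgD target_avg_cst // target_avgZ lerD2l ler_wpM2l //.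
    by rewrite mulr_ge0.
  exact: target_avg_le_sum.
apply: le_trans (lerD (ler_wpM2l r0 hv) (ler_wpM2l _ hr)) _; first by rewrite subr_ge0.
(* The slack is exactly [r]: the squared rewiring increment costs only [1 - r], while the claim
   allows 1. *)
rewrite -subr_ge0 (_ : _ - _ = r) //.
by rewrite -/r; ring.
Qed.

End one_step_bounds.

(** * The initial law *)

Section initial_law.
Context (R : realType) (N : nat) (p : R).
Hypothesis p01 : 0 <= p <= 1.

Let wt (b : bool) : R := if b then p else 1 - p.

Let bernoulli (f : {ffun 'I_N -> bool}) : R := \prod_v wt (f v).

Let bernoulli_ge0 f : 0 <= bernoulli f.
Proof.
have [p0 p1] := andP p01.
by apply: prodr_ge0 => v _; rewrite /wt; case: (f v); lra.
Qed.

Lemma sum_bernoulli : \sum_f bernoulli f = 1.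
Proof.
rewrite -(bigA_distr_bigA (fun _ b => wt b)) big1 // => v _.
by rewrite big_bool /wt /=; lra.
Qed.

(** After expanding the square, each diagonal term is at most 1 and the mixed terms vanish by
    independence. *)
Lemma bernoulli_variance :
  \sum_f bernoulli f * (\sum_v ((f v)%:R - p)) ^+ 2 <= N%:R.
Proof.
have [p0 p1] := andP p01.
under eq_bigr => f _ do rewrite expr2 mulr_suml mulr_sumr.
rewrite exchange_big /=.
rewrite -[N in leRHS]card_ord -sumr_const; apply: ler_sum => v _.
under eq_bigr => f _ do rewrite !mulr_sumr.
rewrite exchange_big (bigD1 v) //= [X in _ + X]big1 ?addr0.
  apply: le_trans (_ : \sum_f bernoulli f <= _); last by rewrite sum_bernoulli.
  apply: ler_sum => f _; rewrite -[leRHS]mulr1 ler_wpM2l //.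
  by case: (f v) => /=; nra.
move=> w wv.
(* [F] absorbs the two centered factors into the product weight, so that the sum factors over
   vertices; the factor at [v] is a centered mean, hence 0. *)
pose F u (b : bool) : R := wt b *
  (if u == v then b%:R - p else 1) * (if u == w then b%:R - p else 1).
transitivity (\sum_(f : {ffun 'I_N -> bool}) \prod_u F u (f u)).
  apply: eq_bigr => f _; rewrite /F !big_split /= -mulrA; congr (_ * (_ * _)).
    by rewrite -big_mkcond big_pred1_eq.
  by rewrite -big_mkcond big_pred1_eq.
rewrite -bigA_distr_bigA (bigD1 v) //= big_bool /F /wt /= eqxx [v == w]eq_sym (negbTE wv).
by rewrite [X in X * _](_ : _ = 0) ?mul0r //; ring.
Qed.

(** For each fixed regular graph the bound is the variance bound for the opinions; the total weight
    of the regular graphs is at most 1. *)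
Lemma evoter_init_sum_le (L : nat) (F : state N -> R) (A B : R) :
    0 <= A -> 0 <= B ->
    (forall s, regular L s.1 -> F s <= A + B * ((ones s)%:R - p * N%:R) ^+ 2) ->
  \sum_s evoter_init p L s * F s <= A + B * N%:R.
Proof.
move=> A0 B0 FAB.
pose c : R := #|[set g : sgraph N | regular L g]%SET|%:R^-1.
have c0 : 0 <= c by rewrite invr_ge0.
have AB0 : 0 <= A + B * N%:R by rewrite addr_ge0 ?mulr_ge0.
rewrite (eq_bigr (fun s : state N => evoter_init p L (s.1, s.2) * F (s.1, s.2)));
  last by case.
rewrite -(pair_bigA _ (fun g f => evoter_init p L (g, f) * F (g, f))) /=.
apply: le_trans (_ : \sum_(g : sgraph N | regular L g) c * (A + B * N%:R) <= _).
  rewrite [leRHS]big_mkcond; apply: ler_sum => g _.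
  case: ifP => regg; last first.
    by rewrite big1 // => f _; rewrite /evoter_init regg !mul0r.
  apply: le_trans (_ : c * (\sum_f (A * bernoulli f +
      B * (bernoulli f * (\sum_v ((f v)%:R - p)) ^+ 2))) <= _).
    rewrite mulr_sumr; apply: ler_sum => f _.
    rewrite /evoter_init regg mul1r -/(bernoulli f) -/c -mulrA ler_wpM2l //.
    apply: le_trans (ler_wpM2l (bernoulli_ge0 f) (FAB (g, f) regg)) _.
    have -> : \sum_v ((f v)%:R - p) = (ones (g, f))%:R - p * N%:R.
      by rewrite onesE natr_sum sumrB sumr_const card_ord mulr_natr.
    by rewrite le_eqVlt; apply/orP; left; apply/eqP; ring.
  rewrite ler_wpM2l // big_split /= -!mulr_sumr sum_bernoulli mulr1 lerD2l.
  by rewrite ler_wpM2l // bernoulli_variance.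
rewrite sumr_const -[leLHS]mulr_natl mulrA -[leRHS]mul1r ler_wpM2r //.
rewrite (_ : #|_| = #|[set g : sgraph N | regular L g]%SET|); last first.
  by apply: eq_card => g; rewrite inE.
(* Without any regular graph the total weight is 0, since the inverse of 0 is 0. *)
rewrite /c; case: (#|_|) => [|n]; first by rewrite mul0r.
by rewrite mulfV // pnatr_eq0.
Qed.

End initial_law.

(** * The estimate for a fixed number of vertices *)

Section finite_bound.
Context (R : realType).

Lemma small_degree_targets (N M : nat) : 1000 * M.+1%:R <= N%:R :> R ->
  (M.+1 < N)%N /\ 999 * N%:R <= 1000 * (N - M.+1)%:R :> R.
Proof.
move=> h; have M0 : 0 < M.+1%:R :> R by rewrite ltr0n.
have lt : (M.+1 < N)%N by rewrite -(ltr_nat R); lra.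
by split => //; rewrite natrB 1?ltnW //; lra.
Qed.

Let th_gt0 : 0 < 1 + 1 / 200 :> R. Proof. by lra. Qed.
Let th_ge0 : 0 <= 1 / 200 :> R. Proof. by lra. Qed.
Let inv_th_ge0 : 0 <= 1 + - (1 / 201) :> R. Proof. by lra. Qed.

(** Exceeding [M] takes a growth of at least [(3 * p + 1 / 50) * L], while the mean number of hits
    is at most [(3 * p + 1 / 200) * L]. For the small parameter 1/200 this gap outweighs the
    second-order loss and leaves a negative exponent linear in [L]. *)
Lemma degree_tail (p : R) (N L M T : nat) :
    0 < p <= 1 / 2 -> (0 < N)%N ->
    M%:R <= (1 + 3 * p + 1 / 50) * L%:R < M.+1%:R -> 1000 * M.+1%:R <= N%:R :> R ->
    T%:R <= 3 * p * N%:R * L%:R ->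
  (1 + (1 / 200 : R)) ^+ L * (1 + (N - M.+1)%:R^-1 * (1 / 200)) ^+ T
    / (1 + 1 / 200) ^+ M.+1 <= expR (- (L%:R / (200 * 201))).
Proof.
move=> /andP[p0 p2] N0 /andP[_ hM] hN hT.
have L0 : 0 <= L%:R :> R by [].
have N0R : 0 < N%:R :> R by rewrite ltr0n.
have leLM : (L <= M.+1)%N by rewrite -(ler_nat R); nra.
have [_ hN1] := small_degree_targets hN; clear hN.
set Q := (N - M.+1)%:R in hN1 *.
have Q0 : 0 < Q by lra.
have powle n (x : R) : 0 <= 1 + x -> (1 + x) ^+ n <= expR x ^+ n.
  by move=> x0; rewrite lerXn2r ?nnegrE ?expR_ge0 ?expR_ge1Dx.
have b_ge0 : 0 <= 1 + Q^-1 * (1 / 200).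
  by apply: addr_ge0; [exact: ler01|apply: mulr_ge0 th_ge0; rewrite invr_ge0 ltW].
have powD (x : R) : x != 0 -> x ^+ L / x ^+ M.+1 = (x ^+ (M.+1 - L))^-1.
  move=> x0; rewrite -{1}(subnKC leLM) exprD invfM mulrA divff ?mul1r //.
  by rewrite expf_neq0.
rewrite mulrAC powD ?lt0r_neq0 //.
(* Since the inverse of 201/200 is 1 - 1/201, the bound of [1 + x] by [expR x] also applies to the
   denominator. *)
have -> : ((1 + 1 / 200) ^+ (M.+1 - L))^-1 = (1 + (- (1 / 201))) ^+ (M.+1 - L) :> R.
  by rewrite -exprVn; congr (_ ^+ _); field.
apply: le_trans (_ : expR (- (1 / 201)) ^+ (M.+1 - L) * expR (Q^-1 * (1 / 200)) ^+ T <= _).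
  by apply: ler_pM; [exact: exprn_ge0|exact: exprn_ge0|exact: powle|exact: powle].
rewrite -!expRM_natl -expRD ler_expR.
have QT : Q^-1 * T%:R <= (3 * p + 1 / 200) * L%:R.
  rewrite mulrC ler_pdivrMr //.
  apply: (le_trans hT).
  rewrite [leRHS]mulrAC ler_wpM2r //.
  have pN : p * N%:R <= p * (1000 / 999 * Q) by rewrite ler_wpM2l ?(ltW p0) //; lra.
  have pQ : p * Q <= 1 / 2 * Q by rewrite ler_wpM2r ?(ltW Q0).
  by lra.
have hk : (3 * p + 1 / 50) * L%:R <= (M.+1 - L)%:R.
  by rewrite natrB //; lra.
have pL : p * L%:R <= 1 / 2 * L%:R by rewrite ler_wpM2r.
set k := (M.+1 - L)%:R in hk *.
set y := Q^-1 * T%:R in QT.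
have -> : T%:R * (Q^-1 * (1 / 200)) = y / 200 by rewrite /y; ring.
lra.
Qed.

(** * The combined potential, with numerical constants, for fixed [N] *)

Context (p nu eps : R) (N L M T : nat).
Hypothesis hp : 0 < p <= 1 / 2.
Hypothesis hnu : 0 < nu <= 15%:R / 100%:R / (1 + 3%:R * p).
Hypothesis heps : 0 < eps.
Hypothesis LR : 1000 <= L%:R :> R.
Hypothesis pN_ge : 1 <= p * N%:R.
Hypothesis hM : M%:R <= (1 + 3 * p + 1 / 50) * L%:R < M.+1%:R.
Hypothesis hMN : 1000 * M.+1%:R <= N%:R :> R.
Hypothesis hT : 3 * p * N%:R * L%:R - 3 / 2 <= T%:R <= 3 * p * N%:R * L%:R.

Let th : R := 1 / 200.
(** A speed above 1/3, so that [3 * c] exceeds 1, yet below the available drift 0.35. *)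
Let c : R := 17 / 50.
(** Half of [p * (3 * c - 1)]; the other half absorbs the rounding of the horizon [T]. *)
Let kap : R := p / 100.
Let r : R := nu / L%:R.
Let q : R := (N - M.+1)%:R^-1.
Let sig : R := r * (M%:R + c) ^+ 2 + 1.
Let b0 : R := p * N%:R * L%:R.

(* The summands control the degrees, the number of discordant edges and the
   number of ones; each is at least 1 when the quantity it controls is bad. The
   terms in [T - t] compensate for the growth still to come. *)
Let V (t : nat) (s : state N) : R :=
  degree_potential th s * (1 + q * th) ^+ (T - t) / (1 + th) ^+ M.+1 +
  (pos_sqr (#|discordant s|%:R + (c * t%:R - b0)) + (T - t)%:R * sig) /
     (kap * N%:R * L%:R) ^+ 2 +
  (((ones s)%:R - p * N%:R) ^+ 2 + (T - t)%:R * r) / (eps * N%:R) ^+ 2.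

Let live (s : state N) :=
  (discordant s != finset.set0) && [forall v, (#|neighbors s.1 v| <= M)%N].

Let good (s : state N) :=
  (discordant s == finset.set0) && (p - eps <= frac1 R s <= p + eps).

Let p0 : 0 < p. Proof. by case/andP: hp. Qed.
Let p2 : p <= 1 / 2. Proof. by case/andP: hp. Qed.
Let L0 : 0 < L%:R :> R. Proof. by have := LR; lra. Qed.
Let N0 : 0 < N%:R :> R.
Proof. by rewrite ltr0n; have [/ltnW/(leq_trans _)->] := small_degree_targets hMN. Qed.
Let nu0 : 0 < nu. Proof. by case/andP: hnu. Qed.
Let nu1 : nu * (1 + 3 * p) <= 15 / 100.
Proof. by case/andP: hnu => _; rewrite ler_pdivlMr //; have := p0; lra. Qed.
Let nu2 : nu <= 15 / 100.
Proof. by have := nu1; have := p0; have := nu0; nra. Qed.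
Let r0 : 0 <= r. Proof. by rewrite /r divr_ge0 // ltW. Qed.
Let rL : r * L%:R = nu. Proof. by rewrite /r divfK // gt_eqF. Qed.
Let r1 : r <= 1 / 1000.
Proof. by rewrite /r ler_pdivrMr //; have := nu2; have := LR; nra. Qed.
Let q0 : 0 <= q. Proof. by rewrite invr_ge0. Qed.
Let qN : q * N%:R <= 1000 / 999.
Proof.
have [lt h] := small_degree_targets hMN.
by rewrite /q mulrC ler_pdivrMr ?ltr0n ?subn_gt0 //; lra.
Qed.
Let Mle : M%:R <= (1 + 3 * p + 1 / 50) * L%:R. Proof. by case/andP: hM. Qed.
Let sig0 : 0 <= sig. Proof. by rewrite /sig addr_ge0 // mulr_ge0 // sqr_ge0. Qed.
Let den1 : 0 < (kap * N%:R * L%:R) ^+ 2.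
Proof. by rewrite exprn_gt0 // !mulr_gt0 // /kap divr_gt0. Qed.
Let den2 : 0 < (eps * N%:R) ^+ 2.
Proof. by rewrite exprn_gt0 // mulr_gt0. Qed.
Let th1 : 0 < 1 + th. Proof. by rewrite /th; lra. Qed.
Let th0 : 0 <= th. Proof. by rewrite /th; lra. Qed.

(** Votes contribute at most 0.15 + 0.003, the second part coming from the margin 1/50 in [M];
    rewirings contribute less than -0.159 per event. The gap of 0.006 covers the terms with
    [r <= 1 / 1000]. *)
Let drift : r * (M%:R + c) + (1 - r) * (c - 1 + q * N%:R / 2) <= 0.
Proof.
have h1 : r * M%:R <= 153 / 1000.
  apply: le_trans (ler_wpM2l r0 Mle) _.
  rewrite mulrCA rL.
  by have := nu1; have := nu2; lra.
have := qN; set x := q * N%:R => hx.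
have h2 : (1 - r) * (c - 1 + x / 2) <= (1 - r) * (- (159 / 1000)).
  by rewrite ler_wpM2l //; [have := r1|rewrite /c]; lra.
by have := r1; have := r0; rewrite /c mulrDr in h2 *; lra.
Qed.

(** As [M + c <= 3 * L], the vote term is at most [9 * nu * L]. Over [T] steps the accumulated
    square is then of order [N * L ^+ 2], small against [(N * L) ^+ 2]. *)
Let sig_le : sig <= 2 * L%:R.
Proof.
have h : 0 <= M%:R + c <= 3 * L%:R.
  apply/andP; split; first by rewrite addr_ge0 // /c; lra.
  by have := Mle; have := p2; have := LR; rewrite /c; nra.
case/andP: h => h1 h2.
have h3 : (M%:R + c) ^+ 2 <= (3 * L%:R) ^+ 2 by rewrite lerXn2r ?nnegrE //; lra.
rewrite /sig; have := ler_wpM2l r0 h3.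
rewrite (_ : r * (3 * L%:R) ^+ 2 = 9 * (r * L%:R) * L%:R); last by ring.
by rewrite rL; have := nu2; have := LR; nra.
Qed.

Let dp_ge0 (s : state N) : 0 <= degree_potential th s :> R.
Proof. by apply: sumr_ge0 => w _; rewrite exprn_ge0 // ltW. Qed.

Let term1_ge0 t (s : state N) :
  0 <= degree_potential th s * (1 + q * th) ^+ (T - t) / (1 + th) ^+ M.+1.
Proof.
rewrite divr_ge0 ?exprn_ge0 //; last exact: ltW.
by rewrite mulr_ge0 // exprn_ge0 // addr_ge0 // mulr_ge0.
Qed.

Let term2_ge0 t (s : state N) :
  0 <= (pos_sqr (#|discordant s|%:R + (c * t%:R - b0)) + (T - t)%:R * sig) /
     (kap * N%:R * L%:R) ^+ 2.
Proof.
by rewrite divr_ge0 ?(ltW den1) // addr_ge0 ?pos_sqr_ge0 // mulr_ge0.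
Qed.

Let term3_ge0 t (s : state N) :
  0 <= (((ones s)%:R - p * N%:R) ^+ 2 + (T - t)%:R * r) / (eps * N%:R) ^+ 2.
Proof.
by rewrite divr_ge0 ?(ltW den2) // addr_ge0 ?sqr_ge0 // mulr_ge0.
Qed.

Let V_ge0 t s : 0 <= V t s.
Proof. by rewrite /V !addr_ge0. Qed.

Let V_step t s : (t < T)%N -> live s ->
  \sum_s' evoter_trans nu L s s' * V t.+1 s' <= V t s.
Proof.
move=> ltT /andP[disc /forallP degM].
have nuL : 0 <= nu / L%:R <= 1 by rewrite r0 /=; have := r1; rewrite /r; lra.
have [ltMN _] := small_degree_targets hMN.
(* Each step consumes one unit of [T - t], which pays the factor [1 + q * th] and the increments
   [sig] and [r]. *)
have TS : (T - t)%N = (T - t.+1).+1 by rewrite subnSK.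
(* The deterministic compensators pass through the kernel only because its total mass is 1. *)
have K1 : \sum_s' evoter_trans nu L s s' = 1 :> R.
  rewrite -[RHS](davg_cst 1 disc).
  under eq_bigr => s' _ do rewrite -[evoter_trans _ _ _ _]mulr1.
  have t0 v := rewire_targets_neq0 v ltMN degM.
  rewrite (evoter_trans_sum nu L (fun=> 1)) //.
  congr davg; apply/funext => v; apply/funext => u.
  by rewrite target_avg_cst // !mulr1 addrC subrK.
rewrite /V.
have dist (x a1 a2 a3 i1 i2 i3 : R) :
  x * (a1 * i1 + a2 * i2 + a3 * i3) = x * a1 * i1 + x * a2 * i2 + x * a3 * i3.
  by ring.
under eq_bigr => s' _ do rewrite dist.
rewrite !big_split /= -!mulr_suml; apply: lerD; first apply: lerD.
- rewrite ler_wpM2r ?invr_ge0 ?exprn_ge0 ?(ltW th1) //.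
  under eq_bigr => s' _ do rewrite mulrA.
  rewrite -mulr_suml TS exprS mulrA ler_wpM2r ?exprn_ge0 ?addr_ge0 ?mulr_ge0 //.
  by rewrite [leRHS]mulrC; exact: degree_potential_step.
- rewrite ler_wpM2r ?invr_ge0 ?(ltW den1) //.
  under eq_bigr => s' _ do rewrite mulrDr.
  rewrite big_split /= -mulr_suml K1 mul1r TS -[in leRHS]natr1 [in leRHS]mulrDl mul1r.
  rewrite [leRHS]addrCA [leRHS]addrC lerD2r.
  have -> : c * t.+1%:R - b0 = c + (c * t%:R - b0) by rewrite -natr1; ring.
  under eq_bigr => s' _ do rewrite addrA.
  by apply: discordant_step => //; rewrite /c; lra.
- rewrite ler_wpM2r ?invr_ge0 ?(ltW den2) //.
  under eq_bigr => s' _ do rewrite mulrDr.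
  rewrite big_split /= -mulr_suml K1 mul1r TS -[in leRHS]natr1 [in leRHS]mulrDl mul1r.
  rewrite [leRHS]addrCA [leRHS]addrC lerD2r.
  exact: (ones_step _ _ ltMN degM).
Qed.


Let b0_ge : 1000 <= b0.
Proof.
have h : 1 * L%:R <= p * N%:R * L%:R by rewrite ler_wpM2r // ltW.
by rewrite mul1r in h; exact: le_trans LR h.
Qed.

(** The second summand alone reaches 1: at the horizon [c * T] exceeds [b0] by at least [b0 / 100],
    whatever the number of discordant edges. *)
Let V_end s : live s -> 1 <= V T s.
Proof.
move=> _; rewrite /V; apply: le_trans (_ : 0 + pos_sqr (#|discordant s|%:R + (c * T%:R - b0)) /
    (kap * N%:R * L%:R) ^+ 2 + 0 <= _); last first.
  apply: lerD; last exact: term3_ge0.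
  apply: lerD; first exact: term1_ge0.
  by rewrite subnn mul0r addr0.
rewrite addr0 add0r ler_pdivlMr // mul1r.
have -> : kap * N%:R * L%:R = b0 / 100 by rewrite /kap /b0; ring.
have y_ge : b0 / 100 <= #|discordant s|%:R + (c * T%:R - b0).
  have D0 : 0 <= #|discordant s|%:R :> R by [].
  have := b0_ge; case/andP: hT => hT1 _; rewrite /c.
  have hb : 3 * p * N%:R * L%:R = 3 * b0 by rewrite /b0; ring.
  rewrite hb in hT1.
  by lra.
have b00 : 0 <= b0 / 100 by have := b0_ge; lra.
rewrite /pos_sqr lerXn2r ?nnegrE // ?le_max ?lexx ?orbT // y_ge.
by [].
Qed.

(** An exit without discordant edges that is not good has [ones] off by at least [eps * N], which
    the third summand detects. Any other exit has a vertex of degree above [M], whose own weight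
    makes the first summand at least 1. *)
Let V_bad t s : (t <= T)%N -> ~~ live s -> ~~ good s -> 1 <= V t s.
Proof.
move=> _; rewrite /live negb_and negbK => /orP[D0|].
  rewrite /good D0 /= => nfrac.
  rewrite /V; apply: le_trans (_ : 0 + 0 + ((ones s)%:R - p * N%:R) ^+ 2 /
    (eps * N%:R) ^+ 2 <= _); last first.
    apply: lerD; first by apply: lerD; [exact: term1_ge0|exact: term2_ge0].
    by rewrite ler_wpM2r ?invr_ge0 ?(ltW den2) // lerDl mulr_ge0.
  rewrite !add0r ler_pdivlMr // mul1r -[leRHS]real_normK ?num_real // lerXn2r ?nnegrE //.
    by rewrite mulr_ge0 // ltW.
  rewrite leNgt; apply: contraNN nfrac.
  rewrite ltr_norml => /andP[h1 h2].
  rewrite /frac1 -/(ones s) ler_pdivlMr // ler_pdivrMr //.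
  by apply/andP; split; rewrite ?mulrBl ?mulrDl; lra.
rewrite negb_forall => /existsP[v]; rewrite -ltnNge => Mv _.
rewrite /V -addrA -[leLHS]addr0; apply: lerD; last first.
  by apply: addr_ge0; [exact: term2_ge0|exact: term3_ge0].
rewrite ler_pdivlMr ?exprn_gt0 // mul1r.
apply: le_trans (_ : degree_potential th s * 1 <= _); last first.
  by rewrite ler_wpM2l // exprn_ege1 // lerDl mulr_ge0.
rewrite mulr1 /degree_potential (bigD1 v) //=.
apply: le_trans (_ : (1 + th) ^+ #|neighbors s.1 v| + 0 <= _); last first.
  by rewrite lerD2l sumr_ge0 // => w _; rewrite exprn_ge0 // ltW.
by rewrite addr0 ler_weXn2l // lerDl.
Qed.

(** At time 0 the potential is at most a constant [A] plus [B] times the squared deviation of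
    [ones], whose mean is at most [N]. The coefficients 4 and 2 split as 3 + 1 and 1 + 1:
    compensators plus initial variance. *)
Let init_bound :
  \sum_s evoter_init p L s * V 0%N s <=
  N%:R * expR (- (L%:R / (200 * 201))) +
    (4 / (p / 100) ^+ 2 + 2 / eps ^+ 2) / N%:R.
Proof.
pose i1 := N%:R * ((1 + th) ^+ L * (1 + q * th) ^+ T / (1 + th) ^+ M.+1).
pose A := i1 + T%:R * sig / (kap * N%:R * L%:R) ^+ 2 + T%:R * r / (eps * N%:R) ^+ 2.
pose B := L%:R ^+ 2 / (kap * N%:R * L%:R) ^+ 2 + 1 / (eps * N%:R) ^+ 2.
have i10 : 0 <= i1.
  rewrite mulr_ge0 // divr_ge0 ?exprn_ge0 ?(ltW th1) //.
  by rewrite mulr_ge0 ?exprn_ge0 ?(ltW th1) // addr_ge0 // mulr_ge0.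
have A0 : 0 <= A.
  by rewrite !addr_ge0 // divr_ge0 ?(ltW den1) ?(ltW den2) // mulr_ge0.
have B0 : 0 <= B.
  by rewrite addr_ge0 // divr_ge0 ?(ltW den1) ?(ltW den2) // sqr_ge0.
have p01 : 0 <= p <= 1 by have := p0; have := p2; lra.
have VAB s : regular L s.1 -> V 0%N s <= A + B * ((ones s)%:R - p * N%:R) ^+ 2.
  move=> reg.
  have dpE : degree_potential th s = N%:R * (1 + th) ^+ L.
    rewrite /degree_potential (eq_bigr (fun=> (1 + th) ^+ L)).
      by rewrite sumr_const card_ord mulr_natl.
    by move=> v _; rewrite (eqP (forallP reg v)).
  (* The excess of discordant edges over [b0] is at most [L] times the excess of [ones] over
     [p * N]. *)
  have psE : pos_sqr (#|discordant s|%:R + (c * 0%:R - b0)) <=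
      L%:R ^+ 2 * ((ones s)%:R - p * N%:R) ^+ 2.
    have hD := card_discordant_le reg.
    rewrite -(ler_nat R) natrM in hD.
    rewrite -exprMn mulrBr mulr0 sub0r /pos_sqr.
    have -> : L%:R * (p * N%:R) = b0 by rewrite /b0; ring.
    case: (leP _ 0) => [_|pos]; first by rewrite expr0n sqr_ge0.
    have le : #|discordant s|%:R - b0 <= L%:R * (ones s)%:R - b0 by rewrite lerD2r.
    by rewrite lerXn2r ?nnegrE ?(ltW pos) // (le_trans (ltW pos)).
  rewrite /V dpE !subn0.
  have -> : A + B * ((ones s)%:R - p * N%:R) ^+ 2 = i1 +
    (L%:R ^+ 2 * ((ones s)%:R - p * N%:R) ^+ 2 + T%:R * sig) / (kap * N%:R * L%:R) ^+ 2 +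
    (((ones s)%:R - p * N%:R) ^+ 2 + T%:R * r) / (eps * N%:R) ^+ 2.
    by rewrite /A /B; ring.
  rewrite lerD2r; apply: lerD; first by rewrite /i1 !mulrA.
  by rewrite ler_wpM2r ?invr_ge0 ?(ltW den1) // lerD2r.
apply: (le_trans (evoter_init_sum_le p01 A0 B0 VAB)).
have h1 : i1 <= N%:R * expR (- (L%:R / (200 * 201))).
  rewrite /i1 ler_wpM2l //; apply: (degree_tail (p := p)) => //.
    by rewrite -(ltr_nat R).
  by case/andP: hT.
case/andP: hT => _ hT2.
have h2 : T%:R * sig / (kap * N%:R * L%:R) ^+ 2 <= 3 / (p / 100) ^+ 2 / N%:R.
  have -> : 3 / (p / 100) ^+ 2 / N%:R = 3 * N%:R * L%:R ^+ 2 / (kap * N%:R * L%:R) ^+ 2.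
    by rewrite /kap; field; rewrite !lt0r_neq0.
  rewrite ler_wpM2r ?invr_ge0 ?(ltW den1) //.
  apply: le_trans (ler_pM _ _ hT2 sig_le) _ => //.
  have -> : 3 * p * N%:R * L%:R * (2 * L%:R) = p * (6 * (N%:R * L%:R ^+ 2)) by ring.
  have -> : 3 * N%:R * L%:R ^+ 2 = 1 / 2 * (6 * (N%:R * L%:R ^+ 2)) :> R by field.
  by rewrite ler_wpM2r // !mulr_ge0 // sqr_ge0.
have h3 : T%:R * r / (eps * N%:R) ^+ 2 <= 1 / eps ^+ 2 / N%:R.
  have -> : 1 / eps ^+ 2 / N%:R = N%:R / (eps * N%:R) ^+ 2.
    by field; rewrite !lt0r_neq0.
  rewrite ler_wpM2r ?invr_ge0 ?(ltW den2) //.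
  apply: le_trans (ler_wpM2r r0 hT2) _.
  have -> : 3 * p * N%:R * L%:R * r = 3 * p * (r * L%:R) * N%:R by ring.
  rewrite rL -[leRHS]mul1r ler_wpM2r //.
  by have := nu2; have := p2; have := nu0; have := p0; nra.
have h4 : B * N%:R = 1 / (p / 100) ^+ 2 / N%:R + 1 / eps ^+ 2 / N%:R.
  by rewrite /B /kap; field; rewrite !lt0r_neq0.
rewrite h4 /A.
have -> : (4 / (p / 100) ^+ 2 + 2 / eps ^+ 2) / N%:R =
  3 / (p / 100) ^+ 2 / N%:R + 1 / eps ^+ 2 / N%:R +
  (1 / (p / 100) ^+ 2 / N%:R + 1 / eps ^+ 2 / N%:R) by ring.
rewrite !addrA lerD2r lerD2r; apply: lerD h3.
exact: lerD.
Qed.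

(** Live states have a discordant edge, so a first exit from [live] into [good] happens exactly at
    the consensus time. *)
Lemma consensus_prob_ge (d : measure_display) (Omega : measurableType d)
    (P : probability Omega R) (X : nat -> Omega -> state N) (E : set Omega) :
  evoter_process p nu L P X -> measurable E ->
  (forall w t, (t <= T)%N -> is_tau (fun i => X i w) t ->
    p - eps <= frac1 R (X t w) <= p + eps -> E w) ->
  ((1 - (N%:R * expR (- (L%:R / (200 * 201))) +
    (4 / (p / 100) ^+ 2 + 2 / eps ^+ 2) / N%:R))%:E <= P E)%E.
Proof.
move=> hX mE hE.
apply: le_trans (supermartingale_exit_bound hX V_ge0 V_step V_bad V_end mE _).
  by rewrite lee_fin lerB // init_bound.
move=> w t tT h _ /andP[/eqP D0 frac]; apply: (hE w t) => //; split => // i it.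
by have /andP[/eqP] := h i it.
Qed.

End finite_bound.

(** * The limit *)

Section asymptotics.
Context (R : realType).

Lemma powR_nat_infty (b A : R) : 0 < b -> \forall N \near \oo, A <= N%:R `^ b.
Proof.
move=> b0; pose A1 := Num.max A 0.
have A10 : 0 <= A1 by rewrite le_max lexx orbT.
near=> N; apply: (@le_trans _ _ A1); first by rewrite le_max lexx.
rewrite -[leLHS](powRr1 A10) -[X in A1 `^ X](mulVf (lt0r_neq0 b0)) powRrM.
apply: ge0_ler_powR; rewrite ?nnegrE ?powR_ge0 ?(ltW b0) //.
by near: N; exact: nbhs_infty_ger.
Unshelve. all: by end_near. Qed.

Context (a : R) (L : nat -> nat).
Hypothesis a01 : 0 < a < 1.
Hypothesis L_asymp : (L N)%:R / (N%:R `^ a) @[N --> \oo] --> (1 : R).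

Let a0 : 0 < a. Proof. by case/andP: a01. Qed.

Lemma L_le_powR : \forall N \near \oo, (L N)%:R <= 2 * N%:R `^ a.
Proof.
have h := @cvgr_le _ _ _ _ _ 1 L_asymp 2 ltac:(lra).
near=> N.
have Na : 0 < N%:R `^ a by apply: powR_gt0; rewrite ltr0n; near: N; exact: nbhs_infty_gt.
by rewrite -ler_pdivrMr //; near: N.
Unshelve. all: by end_near. Qed.

Lemma powR_le_L : \forall N \near \oo, N%:R `^ a <= 2 * (L N)%:R.
Proof.
have h := @cvgr_ge _ _ _ _ _ 1 L_asymp (1 / 2) ltac:(lra).
near=> N.
have Na : 0 < N%:R `^ a by apply: powR_gt0; rewrite ltr0n; near: N; exact: nbhs_infty_gt.
have : 1 / 2 <= (L N)%:R / N%:R `^ a by near: N.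
by rewrite ler_pdivlMr //; lra.
Unshelve. all: by end_near. Qed.

Lemma L_infty (A : R) : \forall N \near \oo, A <= (L N)%:R.
Proof.
near=> N.
have h1 : N%:R `^ a <= 2 * (L N)%:R by near: N; exact: powR_le_L.
have h2 : 2 * A <= N%:R `^ a by near: N; exact: powR_nat_infty.
lra.
Unshelve. all: by end_near. Qed.

Lemma L_littleo (A : R) : 0 <= A -> \forall N \near \oo, A * (L N)%:R <= N%:R.
Proof.
move=> A0; have a1 : 0 < 1 - a by case/andP: a01 => _; rewrite subr_gt0.
near=> N.
have N0 : 0 < N%:R :> R by rewrite ltr0n; near: N; exact: nbhs_infty_gt.
have h1 : (L N)%:R <= 2 * N%:R `^ a by near: N; exact: L_le_powR.
have h2 : A * 2 <= N%:R `^ (1 - a) by near: N; exact: powR_nat_infty.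
apply: le_trans (ler_wpM2l A0 h1) _.
rewrite mulrA; apply: le_trans (ler_wpM2r (powR_ge0 _ _) h2) _.
by rewrite -powRD ?subrK ?powRr1 ?(ltW N0) // lt0r_neq0 // implybT.
Unshelve. all: by end_near. Qed.

(** With [k] at least the inverse of [a], [N] is at most [(2 * L) ^+ k]; the Taylor term of degree
    [k.+1] of the exponential wins by a factor of order [L]. *)
Lemma N_expR_L_small (c e : R) : 0 < c -> 0 < e ->
  \forall N \near \oo, N%:R * expR (- (c * (L N)%:R)) <= e.
Proof.
move=> c0 e0; have [k ak] : exists k : nat, a^-1 <= k%:R.
  by exists (Num.bound a^-1); apply/ltW/archi_boundP; rewrite invr_ge0 ltW.
pose C := 2 ^+ k * (k.+1)`!%:R / c ^+ k.+1.
have fact0 : 0 < (k.+1)`!%:R :> R by rewrite ltr0n fact_gt0.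
near=> N.
have L0 : 1 <= (L N)%:R :> R by near: N; exact: L_infty.
have L00 : 0 < (L N)%:R :> R by exact: lt_le_trans L0.
have LC : C / e <= (L N)%:R by near: N; exact: L_infty.
have NL : N%:R <= (2 * (L N)%:R) ^+ k :> R.
  rewrite -[leLHS]powRr1 // -[X in _ `^ X](mulfV (lt0r_neq0 a0)) powRrM.
  apply: (@le_trans _ _ ((2 * (L N)%:R) `^ a^-1)).
    apply: ge0_ler_powR; rewrite ?nnegrE ?powR_ge0 ?invr_ge0 ?(ltW a0) ?mulr_ge0 //.
    by near: N; exact: powR_le_L.
  by rewrite -powR_mulrn ?mulr_ge0 // ler_powR //; lra.
have expo : (c * (L N)%:R) ^+ k.+1 / (k.+1)`!%:R <= expR (c * (L N)%:R).
  apply: le_trans (expR_ge1Dxn k _); last by rewrite mulr_ge0 // ltW.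
  by rewrite lerDr.
rewrite expRN ler_pdivrMr ?expR_gt0 //.
apply: le_trans NL _; apply: le_trans (ler_wpM2l (ltW e0) expo).
have -> : (2 * (L N)%:R) ^+ k = C * (c ^+ k.+1 * (L N)%:R ^+ k / (k.+1)`!%:R).
  by rewrite /C exprMn; field; rewrite !lt0r_neq0 ?exprn_gt0.
have -> : e * ((c * (L N)%:R) ^+ k.+1 / (k.+1)`!%:R) =
    (e * (L N)%:R) * (c ^+ k.+1 * (L N)%:R ^+ k / (k.+1)`!%:R).
  by rewrite exprMn [(L N)%:R ^+ k.+1]exprS; ring.
have F0 : 0 <= c ^+ k.+1 * (L N)%:R ^+ k / (k.+1)`!%:R.
  apply: divr_ge0; last exact: ltW.
  by apply: mulr_ge0; apply: exprn_ge0; rewrite ?ltW.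
by rewrite ler_wpM2r // mulrC -ler_pdivrMr.
Unshelve. all: by end_near. Qed.

End asymptotics.

(** * Horizon, degree cap, measurability and the final limit *)

(** Truncating [x - 1 / 2] rather than [x] keeps the inequality strict even when [x] is an integer,
    at the price of a loss of at most 3/2. *)
Lemma exists_nat_below (R : realType) (x : R) : 1 <= x ->
  exists n : nat, x - 3 / 2 <= n%:R /\ n%:R < x.
Proof.
move=> x1; exists (Num.trunc (x - 1 / 2)).
have /truncn_itv/andP[h1 h2] : 0 <= x - 1 / 2 by lra.
set n := Num.trunc _ in h1 h2 *.
by move: h2; rewrite -[n.+1%:R]natr1 => h2; split; lra.
Qed.

(** The factor 4 suffices because [p <= 1 / 2] gives [M.+1 <= 2.52 * l + 1], and [l] is at least
    1. *)
Lemma exists_degree_cap (R : realType) (p l n : R) :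
    0 < p <= 1 / 2 -> 1 <= l -> 4 * (1000 * l) <= n ->
  exists M : nat, M%:R <= (1 + 3 * p + 1 / 50) * l < M.+1%:R /\ 1000 * M.+1%:R <= n.
Proof.
move=> /andP[p0 p2] l1 ln; exists (Num.trunc ((1 + 3 * p + 1 / 50) * l)).
have hM := truncn_itv (_ : 0 <= (1 + 3 * p + 1 / 50) * l).
have {}hM := hM ltac:(apply: mulr_ge0; lra).
set m := Num.trunc _ in hM *.
split => //; case/andP: hM => hM _; rewrite -[m.+1%:R]natr1.
have pl : p * l <= 1 / 2 * l by rewrite ler_wpM2r //; lra.
by lra.
Qed.

Lemma consensus_measurable (R : realType) (N L : nat) (p nu : R)
    (d : measure_display) (Omega : measurableType d) (P : probability Omega R)
    (X : nat -> Omega -> state N) (Q : nat -> state N -> Prop) :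
  evoter_process p nu L P X ->
  measurable [set w | exists t, is_tau (fun i => X i w) t /\ Q t (X t w)].
Proof.
move=> hX; have mX t s : measurable [set w | X t w = s] by case: hX.
rewrite (_ : [set w | _] = \bigcup_t
    ([set w | discordant (X t w) = finset.set0 /\ Q t (X t w)] `&`
     [set w | forall i, (i < t)%N -> discordant (X i w) <> finset.set0])).
  apply: bigcupT_measurable => t; apply: measurableI.
    exact: (fin_fibre_measurable
      (fun s => discordant s = finset.set0 /\ Q t s) (mX t)).
  exact: (bounded_forall_measurable hX t
    (fun _ s => discordant s <> finset.set0)).
apply/seteqP; split => w /=.
  by move=> [t [[D0 Dt] Qt]]; exists t.
by move=> [t _ [[D0 Qt] Dt]]; exists t.
Qed.

Theorem theorem5 (R : realType) (a p eps nu : R) (L : nat -> nat)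
  (ha : 0 < a < 1)
  (hp : 0 < p <= 1 / 2)
  (heps : 0 < eps)
  (hnu : 0 < nu <= 15%:R / 100%:R / (1 + 3%:R * p))
  (L_gt0 : forall N : nat, (0 < N)%N -> (0 < L N)%N)
  (NL_even : forall N : nat, (0 < N)%N -> ~~ odd (N * L N))
  (L_asymp : (L N)%:R / (N%:R `^ a) @[N --> \oo] --> (1 : R))
  (d : nat -> measure_display)
  (Omega : forall N : nat, measurableType (d N))
  (P : forall N : nat, probability (Omega N) R)
  (X : forall N : nat, nat -> Omega N -> state N)
  (* only for large N, since no L-regular graph need exist for small N *)
  (hX : \forall N \near \oo, evoter_process p nu (L N) (P N) (X N)) :
  P N [set w | exists t : nat,
        [/\ is_tau (fun i => X N i w) t,
            t%:R < 3%:R * p * N%:R * (L N)%:R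
          & p - eps <= frac1 R (X N t w) <= p + eps]]
    @[N --> \oo] --> 1%E.
Proof.
have [p0 p2] := andP hp.
pose E N := [set w | exists t : nat,
  is_tau (fun i => X N i w) t /\ (t%:R < 3%:R * p * N%:R * (L N)%:R /\
    p - eps <= frac1 R (X N t w) <= p + eps)].
rewrite (_ : (fun N => P N _) = (fun N => P N (E N))); last first.
  apply/funext => N; congr (P N _); apply/seteqP; split => w [t].
    by case=> *; exists t; split.
  by case=> ? [*]; exists t; split.
have mE : \forall N \near \oo, measurable (E N).
  near=> N; have hXN : evoter_process p nu (L N) (P N) (X N) by near: N.
  exact: (consensus_measurable (fun t s => t%:R < 3%:R * p * N%:R * (L N)%:R /\
    p - eps <= frac1 R s <= p + eps) hXN).
pose C := 4 / (p / 100) ^+ 2 + 2 / eps ^+ 2.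
have K0 : 0 <= 4 * 1000 :> R by lra.
apply: cvg_EFin.
  by near=> N; apply: fin_num_measure; near: N.
apply/cvgrPdist_le => e e0; near=> N.
have mEN : measurable (E N) by near: N.
have L1 : 1000 <= (L N)%:R :> R by near: N; exact: (L_infty ha L_asymp).
have L2 : 4 * (1000 * (L N)%:R) <= N%:R :> R.
  by rewrite mulrA; near: N; exact: (L_littleo ha L_asymp K0).
have N0 : 1 <= N%:R :> R by near: N; exact: nbhs_infty_ger.
have N1 : 1 / p <= N%:R by near: N; exact: nbhs_infty_ger.
(* The error is split evenly: half for the two variance terms [C / N], half for the degree tail. *)
have N2 : C / (e / 2) <= N%:R by near: N; exact: nbhs_infty_ger.
have N3 : N%:R * expR (- ((200 * 201)^-1 * (L N)%:R)) <= e / 2.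
  near: N; apply: (N_expR_L_small ha L_asymp); last by rewrite divr_gt0.
  by rewrite invr_gt0; lra.
have hXN : evoter_process p nu (L N) (P N) (X N) by near: N; exact: hX.
set x := 3 * p * N%:R * (L N)%:R.
have pN : 1 <= p * N%:R by rewrite mulrC -ler_pdivrMr.
have L1' : 1 <= (L N)%:R :> R by near: N; exact: (L_infty ha L_asymp).
have x_ge : 1 <= x.
  have h : 1 * 1 <= p * N%:R * (L N)%:R by apply: ler_pM.
  rewrite /x -!mulrA -[leLHS]mulr1; apply: ler_pM; rewrite ?ler1n //.
  by rewrite mulrA -[leLHS]mulr1.
have [T [T1 T2]] := exists_nat_below x_ge.
have [M [hM hMN]] := exists_degree_cap hp L1' L2.
have hT : x - 3 / 2 <= T%:R <= x by rewrite T1 ltW.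
have := consensus_prob_ge hp hnu heps L1 pN hM hMN hT hXN mEN.
rewrite -[P N (E N)]fineK ?fin_num_measure // lee_fin => /(_ _)/= lowerb.
(* A probability is at most 1, so the distance to the limit is controlled by the lower bound
   alone. *)
have upper : fine (P N (E N)) <= 1.
  by rewrite -lee_fin fineK ?fin_num_measure // probability_le1.
rewrite ger0_norm ?subr_ge0 //.
have CN : C / N%:R <= e / 2.
  by rewrite ler_pdivrMr 1?(lt_le_trans ltr01) // mulrC -ler_pdivrMr // divr_gt0.
rewrite mulrC in N3.
have := lowerb; rewrite -/C [L in expR (- L)]mulrC.
suff : forall w t, (t <= T)%N -> is_tau (fun i => X N i w) t ->
    p - eps <= frac1 R (X N t w) <= p + eps -> E N w.
  by move=> h /(_ h) lo; clear -N3 CN lo; lra.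
move=> w t tT taut frac; exists t; split => //; split => //.
by apply: le_lt_trans T2; rewrite ler_nat.
Unshelve. all: by end_near. Qed.
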